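(* Let $V$ be a finite-dimensional real vector space with $\dim V\ge 2$, with a symmetric invertible metric tensor $g$ of arbitrary signature. Let $R,S\in V$ be nonzero vectors with $(R-S)\cdot(R+S)=R^2-S^2=0$ and $(R-S)^2\neq 0$. Call a nonzero vector $P\in V$ admissible (relative to $R,S$) if $$P\cdot(R+S)\neq 0,\qquad P\wedge(R-S)\neq 0,\qquad \{P\wedge(R-S)\}^2+\{P\cdot(R+S)\}^2=P^2(R-S)^2+4(P\cdot R)(P\cdot S)\neq 0,$$ and for admissible $P$ put $$\mu=\mu(P,R\pm S)=\frac{2P\cdot(R+S)}{\{P\wedge(R-S)\}^2+\{P\cdot(R+S)\}^2}.$$ Consider the isometries $L_{A\wedge B}$ parameterized by simple bivectors $A\wedge B$ (defined in the context). Then each solution $L$ of the link equation $LR=S$ among these isometries is given by the ray spanned by an admissible vector $P$, and all such isometry-links from $R$ to $S$ are parameterized by the variable rays $\{\mu P\}$. That is: (1) For every admissible $P$, the isometry $L_{(\mu P)\wedge(R-S)}$ parameterized by the simple bivector $(\mu P)\wedge(R-S)$ has the explicit form $$L_{(\mu P)\wedge(R-S)}=\mathrm{id}-\frac{2P\otimes\{(R-S)^2\,gP-2(P\cdot R)\,g(R-S)\}}{P^2(R-S)^2+4(P\cdot R)(P\cdot S)}-\frac{(R-S)\otimes\{2P^2\,g(R-S)+4(P\cdot S)\,gP\}}{P^2(R-S)^2+4(P\cdot R)(P\cdot S)},$$ its scalar $\gamma=\gamma_{(\mu P)\wedge(R-S)}$ satisfies $\gamma+1=\mu P\cdot(R+S)$,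 and $$L_{(\mu P)\wedge(R-S)}R=S,\qquad L_{(\mu P)\wedge(R-S)}S=2(\mu P\cdot S)\,S+(1-2\mu P\cdot S)\,R-(R-S)^2\,\mu P .$$ (2) Conversely, every isometry $L_{A\wedge B}$ parameterized by a simple bivector $A\wedge B$ that satisfies $L_{A\wedge B}R=S$ is equal to $L_{(\mu P)\wedge(R-S)}$, as given in (1), for some admissible $P$.
   Context: Notation: $A\cdot B=g(A,B)$, $A^2=A\cdot A$; $gA\in V^*$ is the covector $B\mapsto A\cdot B$; for $A\in V$, $\alpha\in V^*$, $A\otimes\alpha$ is the endomorphism $B\mapsto\alpha(B)A$. The scalar product on bivectors is $(A\wedge B)\cdot(P\wedge Q)=(A\cdot P)(B\cdot Q)-(A\cdot Q)(B\cdot P)$, so $(A\wedge B)^2=A^2B^2-(A\cdot B)^2$. A $g$-isometry is $L\in\mathrm{End}\,V$ with $(LA)\cdot(LB)=A\cdot B$ for all $A,B\in V$. For a simple bivector $A\wedge B$ ($A,B\in V$) with $(A\wedge B)^2\le 1$, the isometry parameterized by $A\wedge B$ is $$L_{A\wedge B}=\mathrm{id}+M+\frac{1}{\gamma+1}M^2,\qquad M=A\otimes gB-B\otimes gA,\qquad \gamma=\gamma_{A\wedge B}=\sqrt{1-(A\wedge B)^2}\ge 0.$$ It depends on $A,B$ only through $A\wedge B$. The vector $\mu P$ depends only on the one-dimensional ray spanned by $P$.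
   Formalization: In (1), the claims about L with γ ≥ 0 are stated under the extra condition μP·(R+S) ≥ 1, shown to be exactly when γ+1 = μP·(R+S) and LR = S hold; for other admissible P they fail, and the formulas are proved with μP·(R+S)−1 in place of γ. *)

(* Defs.v *)
From HB Require Import structures.
From mathcomp Require Import all_boot all_order all_algebra.
From mathcomp Require Import reals.

Set Implicit Arguments.
Unset Strict Implicit.
Unset Printing Implicit Defensive.

Import Order.TTheory GRing.Theory Num.Theory.
Local Open Scope ring_scope.

Definition dual (K : realType) (V : vectType K) : vectType K := 'Hom(V, K^o).

(* A metric tensor is a linear map g : V -> V^*.  The covector gA is [g A] and
   the scalar product A . B is gA applied to B. *)
Definition metric (K : realType) (V : vectType K) := 'Hom(V, dual V).

Definition dot (K : realType) (V : vectType K) (g : metric V) (A B : V) : K :=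
  g A B.

Definition symmetric_metric (K : realType) (V : vectType K) (g : metric V) :=
  forall A B : V, dot g A B = dot g B A.

Definition g_isometry (K : realType) (V : vectType K) (g : metric V)
    (L : 'End(V)) :=
  forall A B : V, dot g (L A) (L B) = dot g A B.

Definition tens_fun (K : realType) (V : vectType K) (A : V) (a : dual V)
    (B : V) : V := a B *: A.

Fact tens_fun_linear (K : realType) (V : vectType K) (A : V) (a : dual V) :
  linear (tens_fun A a).
Proof. by move=> k x y; rewrite /tens_fun linearP scalerDl scalerA. Qed.

HB.instance Definition _ (K : realType) (V : vectType K) (A : V) (a : dual V) :=
  GRing.isLinear.Build K V V _ (tens_fun A a) (tens_fun_linear A a).

Definition tens (K : realType) (V : vectType K) (A : V) (a : dual V) : 'End(V) :=
  linfun (tens_fun A a).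

Lemma tensE (K : realType) (V : vectType K) (A : V) (a : dual V) (B : V) :
  tens A a B = a B *: A.
Proof. by rewrite lfunE. Qed.

(* The bivector A /\ B is the alternating tensor A (x) B - B (x) A, where V (x) V
   is identified with Hom(V^*, V) by letting the second factor be evaluated. *)
Definition wedge_fun (K : realType) (V : vectType K) (A B : V) (a : dual V) : V :=
  a B *: A - a A *: B.

Fact wedge_fun_linear (K : realType) (V : vectType K) (A B : V) :
  linear (wedge_fun A B).
Proof.
move=> k a b; rewrite /wedge_fun !add_lfunE !scale_lfunE !scalerDl scalerBr.
by rewrite !scalerA opprD addrACA.
Qed.

HB.instance Definition _ (K : realType) (V : vectType K) (A B : V) :=
  GRing.isLinear.Build K (dual V) V _ (wedge_fun A B) (wedge_fun_linear A B).

Definition wedge (K : realType) (V : vectType K) (A B : V) : 'Hom(dual V, V) :=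
  linfun (wedge_fun A B).

Lemma wedgeE (K : realType) (V : vectType K) (A B : V) (a : dual V) :
  wedge A B a = a B *: A - a A *: B.
Proof. by rewrite lfunE. Qed.

(* The scalar product (A /\ B) . (P /\ Q), on representatives. *)
Definition bivdot (K : realType) (V : vectType K) (g : metric V)
    (A B P Q : V) : K :=
  dot g A P * dot g B Q - dot g A Q * dot g B P.

Definition bivsq (K : realType) (V : vectType K) (g : metric V) (A B : V) : K :=
  bivdot g A B A B.

(* Only meaningful when [bivsq g A B <= 1]: [Num.sqrt] is 0 on negatives. *)
Definition gamma (K : realType) (V : vectType K) (g : metric V) (A B : V) : K :=
  Num.sqrt (1 - bivsq g A B).

Definition gen (K : realType) (V : vectType K) (g : metric V) (A B : V) : 'End(V) :=
  tens A (g B) - tens B (g A).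

(* id + M + M^2 / (c + 1) for an arbitrary scalar c; L_(A /\ B) is the case
   c = gamma, and c = - gamma is the other square root of 1 - (A /\ B)^2. *)
Definition isoc (K : realType) (V : vectType K) (g : metric V) (c : K)
    (A B : V) : 'End(V) :=
  \1%VF + gen g A B + (c + 1)^-1 *: (gen g A B \o gen g A B)%VF.

Definition iso (K : realType) (V : vectType K) (g : metric V) (A B : V) :
    'End(V) :=
  isoc g (gamma g A B) A B.

Definition admissible (K : realType) (V : vectType K) (g : metric V)
    (R S P : V) : Prop :=
  [/\ P != 0,
      dot g P (R + S) != 0,
      wedge P (R - S) != 0,
      bivsq g P (R - S) + dot g P (R + S) ^+ 2
        = dot g P P * dot g (R - S) (R - S) + 4%:R * dot g P R * dot g P S
    & dot g P P * dot g (R - S) (R - S) + 4%:R * dot g P R * dot g P S != 0].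

Definition mu (K : realType) (V : vectType K) (g : metric V) (R S P : V) : K :=
  2%:R * dot g P (R + S) / (bivsq g P (R - S) + dot g P (R + S) ^+ 2).

Definition link (K : realType) (V : vectType K) (g : metric V) (R S P : V) :
    'End(V) :=
  let D := R - S in
  let N := dot g P P * dot g D D + 4%:R * dot g P R * dot g P S in
  \1%VF
  - N^-1 *: (2%:R *: tens P (dot g D D *: g P - (2%:R * dot g P R) *: g D))
  - N^-1 *: tens D ((2%:R * dot g P P) *: g D + (4%:R * dot g P S) *: g P).

(* Main.v *)
(** If [L_(A /\ B) R = S] then [R - S] lies in the span of [A] and [B], and it is
    nonzero, so [A /\ B] can be rewritten as [P /\ (R - S)].  Comparing the
    coefficients of the independent vectors [P] and [R - S] in [L R = S] then
    gives [P . (R + S) = gamma + 1] and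
    [P^2 (R - S)^2 + 4 (P . R) (P . S) = 2 (gamma + 1)], so that [P] is admissible
    with [mu P = P].  In the other direction [mu] is chosen so that
    [mu P . (R + S) - 1] is a square root of [1 - (mu P /\ (R - S))^2]; that root is
    [gamma] exactly when it is nonnegative. *)

Require Import Defs.
From mathcomp Require Import all_boot all_order all_algebra.
From mathcomp Require Import reals ring.

Set Implicit Arguments.
Unset Strict Implicit.
Unset Printing Implicit Defensive.

Import Order.TTheory GRing.Theory Num.Theory.
Local Open Scope ring_scope.

Section LinkEquation.
Variables (K : realType) (V : vectType K) (g : metric V).
Implicit Types (A B P Q X Y : V) (c x y z w : K).

(** * Bilinearity and coefficient formulas *)

Lemma dotDl A B X : dot g (A + B) X = dot g A X + dot g B X.
Proof. by rewrite /dot linearD add_lfunE. Qed.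

Lemma dotZl x A X : dot g (x *: A) X = x * dot g A X.
Proof. by rewrite /dot linearZ scale_lfunE. Qed.

Lemma dotDr A X Y : dot g A (X + Y) = dot g A X + dot g A Y.
Proof. by rewrite /dot linearD. Qed.

Lemma dotZr x A X : dot g A (x *: X) = x * dot g A X.
Proof. by rewrite /dot linearZ. Qed.

Lemma dotNl A X : dot g (- A) X = - dot g A X.
Proof. by rewrite -scaleN1r dotZl mulN1r. Qed.

Lemma dotNr A X : dot g A (- X) = - dot g A X.
Proof. by rewrite -scaleN1r dotZr mulN1r. Qed.

Definition dotE := (dotDl, dotDr, dotNl, dotNr, dotZl, dotZr).

Lemma genE A B X : gen g A B X = dot g B X *: A - dot g A X *: B.
Proof. by rewrite /gen add_lfunE opp_lfunE !tensE. Qed.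

(** Collecting the value on [A] and [B] reduces comparisons with [linkE] to scalar identities that
    [field] decides. *)
Lemma isocE c A B X :
  isoc g c A B X = X +
    ((dot g B X + (c + 1)^-1 * (dot g B A * dot g B X - dot g B B * dot g A X))
       *: A
     + ((c + 1)^-1 * (dot g A B * dot g A X - dot g A A * dot g B X) - dot g A X)
       *: B).
Proof.
rewrite /isoc 2!add_lfunE id_lfunE scale_lfunE comp_lfunE !genE !dotE -addrA.
congr (_ + _); rewrite scalerBr !scalerA addrACA -scalerDl -opprD -scalerDl.
rewrite -scaleNr; congr (_ *: _ + _ *: _); ring.
Qed.

Lemma linkE (R S P X : V) :
  let D := R - S in
  let N := dot g P P * dot g D D + 4%:R * dot g P R * dot g P S in
  link g R S P X = X +
    (- (N^-1 * (2%:R * (dot g D D * dot g P X - 2%:R * dot g P R * dot g D X)))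
       *: P
     + - (N^-1 * (2%:R * dot g P P * dot g D X + 4%:R * dot g P S * dot g P X))
       *: D).
Proof.
rewrite /link /= !add_lfunE !opp_lfunE !scale_lfunE id_lfunE !tensE.
by rewrite !add_lfunE !opp_lfunE !scale_lfunE !scalerA !scaleNr !mulrA addrA.
Qed.

(** * Change of representative of a bivector *)

Lemma gen_lincomb A B x y z w :
  gen g (x *: A + y *: B) (z *: A + w *: B) = (x * w - y * z) *: gen g A B.
Proof.
apply/lfunP => X; rewrite scale_lfunE !genE !dotE !scalerDr !scalerN !scalerA.
rewrite opprD addrACA -!scalerBl -scaleNr.
by congr (_ *: _ + _ *: _); ring.
Qed.

Hypothesis g_sym : symmetric_metric g.

Lemma bivsq_lincomb A B x y z w :
  bivsq g (x *: A + y *: B) (z *: A + w *: B) = (x * w - y * z) ^+ 2 * bivsq g A B.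
Proof. by rewrite /bivsq /bivdot !dotE (g_sym B A); ring. Qed.

Lemma iso_lincomb A B x y z w : x * w - y * z = 1 ->
  iso g (x *: A + y *: B) (z *: A + w *: B) = iso g A B.
Proof.
move=> e; rewrite /iso /isoc /gamma gen_lincomb bivsq_lincomb.
by rewrite e expr1n mul1r scale1r.
Qed.

(** A nonzero coefficient pair [(x, y)] completes to a 2 by 2 matrix of determinant 1, and such a
    change of vectors preserves the bivector. *)
Lemma exists_wedge_factor A B x y : x *: A + y *: B != 0 ->
  exists P, iso g A B = iso g P (x *: A + y *: B).
Proof.
move=> nz; suff [z [w e]] : exists z w, z * y - w * x = 1.
  by exists (z *: A + w *: B); rewrite iso_lincomb.
have [x0|x0] := eqVneq x 0; last by exists 0, (- x^-1); field.
have [y0|y0] := eqVneq y 0; last by exists y^-1, 0; field.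
by rewrite x0 y0 !scale0r addr0 eqxx in nz.
Qed.

Lemma isoc_isometry c A B :
  c + 1 != 0 -> c ^+ 2 = 1 - bivsq g A B -> g_isometry g (isoc g c A B).
Proof.
move=> c1 c2 X Y; rewrite !isocE !dotE (g_sym X A) (g_sym X B) (g_sym B A).
(* [M = gen g A B] is skew and [M^3 = - bivsq g A B *: M], so the defect of
   isometry is a multiple of [M X . M Y]. *)
transitivity (dot g X Y + (c + 1)^-1 ^+ 2 * (bivsq g A B - (1 - c ^+ 2))
  * dot g (gen g A B X) (gen g A B Y)); last by rewrite c2; ring.
rewrite !genE /bivsq /bivdot !dotE (g_sym B A).
by field.
Qed.

Lemma gamma_ge0 A B : 0 <= gamma g A B.
Proof. exact: sqrtr_ge0. Qed.

Lemma gamma_sqr A B : bivsq g A B <= 1 -> gamma g A B ^+ 2 = 1 - bivsq g A B.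
Proof. by move=> le1; rewrite sqr_sqrtr // subr_ge0. Qed.

Lemma gamma1_neq0 A B : gamma g A B + 1 != 0.
Proof. by rewrite gt_eqF // ltr_wpDl ?gamma_ge0. Qed.

Lemma iso_isometry A B : bivsq g A B <= 1 -> g_isometry g (iso g A B).
Proof.
by move=> le1; apply: isoc_isometry (gamma1_neq0 A B) (gamma_sqr le1).
Qed.

Lemma wedge_collinear A x : wedge (x *: A) A = 0.
Proof.
apply/lfunP => f; rewrite wedgeE zero_lfunE.
have -> : f (x *: A) = x * f A by rewrite linearZ.
by rewrite scalerA mulrC subrr.
Qed.

(** By symmetry of [g], [gen g A B X] is the tensor [wedge A B] evaluated at the covector [g X]. *)
Lemma gen_wedge0 A B : wedge A B = 0 -> gen g A B = 0.
Proof.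
move=> w0; apply/lfunP => X; rewrite genE zero_lfunE.
rewrite /dot (g_sym A X : g A X = g X A) (g_sym B X : g B X = g X B).
by rewrite -wedgeE w0 zero_lfunE.
Qed.

Lemma wedge_free P D x y : wedge P D != 0 -> x *: P + y *: D = 0 ->
  x = 0 /\ y = 0.
Proof.
move=> w0 e; have x0 : x = 0.
  apply/eqP; apply: contraNT w0 => x0; apply/eqP.
  have -> : P = (- (x^-1 * y)) *: D; last exact: wedge_collinear.
  apply: (scalerI x0); rewrite scalerA mulrN mulVKf // scaleNr.
  by apply/eqP; rewrite -addr_eq0 e.
split=> //; apply/eqP; apply: contraNT w0 => y0; move: e.
rewrite x0 scale0r add0r => /eqP; rewrite scaler_eq0 (negPf y0) /= => /eqP ->.
apply/eqP/lfunP => f; rewrite wedgeE zero_lfunE linear0 scale0r scaler0.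
by rewrite subrr.
Qed.

(** * The explicit link and its dependence on the ray of [P] *)

Variables R S : V.
Local Notation D := (R - S).
Local Notation N P :=
  (dot g P P * dot g D D + 4%:R * dot g P R * dot g P S).

Lemma bivsq_link_denominator P :
  bivsq g P D + dot g P (R + S) ^+ 2 = N P.
Proof. by rewrite /bivsq /bivdot !dotE (g_sym R P) (g_sym S P); ring. Qed.

Lemma muE P : mu g R S P = 2%:R * dot g P (R + S) / N P.
Proof. by rewrite /mu bivsq_link_denominator. Qed.

Lemma muZ k P : k != 0 -> mu g R S (k *: P) *: (k *: P) = mu g R S P *: P.
Proof.
move=> k0; rewrite scalerA !muE; congr (_ *: _).
have -> : N (k *: P) = k ^+ 2 * N P by rewrite !dotE; ring.
(* If [N P = 0], both values of [mu] are 0, since the inverse of 0 is 0. *)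
have [->|N0] := eqVneq (N P) 0; first by rewrite mulr0 invr0 !(mulr0, mul0r).
rewrite dotZl; field.
by rewrite k0 N0.
Qed.

Lemma admissibleZ k P : k != 0 -> admissible g R S P ->
  admissible g R S (k *: P).
Proof.
move=> k0 [P0 PS w0 _ N0]; split; rewrite ?bivsq_link_denominator //.
- by rewrite scaler_eq0 negb_or k0.
- by rewrite dotZl mulf_neq0.
- apply: contraNneq w0 => e; apply/eqP/lfunP => f; rewrite zero_lfunE.
  apply: (scalerI k0); rewrite scaler0.
  move/lfunP/(_ f): e; rewrite !wedgeE zero_lfunE => <-; rewrite scalerBr.
  have -> : f (k *: P) = k * f P by rewrite linearZ.
  by rewrite !scalerA mulrC.
- have -> : N (k *: P) = k ^+ 2 * N P by rewrite !dotE; ring.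
  by rewrite mulf_neq0 // expf_neq0.
Qed.

(** With [c + 1 = mu P . (R + S)], which is [2 (P . (R + S))^2 / N P], the quadratic term acquires
    the coefficient [mu^2 / (c + 1) = 2 / N P]; this is where the denominator of [link] comes
    from. *)
Lemma isoc_link P : dot g P (R + S) != 0 -> N P != 0 ->
  let Q := mu g R S P *: P in
  isoc g (dot g Q (R + S) - 1) Q D = link g R S P.
Proof.
move=> PS N0 Q; apply/lfunP => X; rewrite isocE linkE subrK /Q muE.
congr (_ + _); rewrite scalerA !(dotZl, dotZr); move: PS N0.
have [-> [-> ->]] : dot g P (R + S) = dot g P R + dot g P S /\
  dot g P (R - S) = dot g P R - dot g P S /\
  dot g (R - S) P = dot g P R - dot g P S.
  by rewrite !dotE (g_sym R P) (g_sym S P).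
set d := dot g D D; move: (dot g P P) (dot g P R) (dot g P S) => p a b PS N0.
by congr (_ *: _ + _ *: _); field; rewrite N0 PS.
Qed.

(** Put [s = P . (R + S)]. Since [(P /\ D)^2 = N P - s^2] and [mu = 2 s / N P], both sides equal
    [(2 s^2 / N P - 1)^2]. *)
Lemma root_link P : dot g P (R + S) != 0 -> N P != 0 ->
  let Q := mu g R S P *: P in
  (dot g Q (R + S) - 1) ^+ 2 = 1 - bivsq g Q D.
Proof.
move=> PS N0 Q; rewrite /Q muE.
have -> : bivsq g ((2%:R * dot g P (R + S) / N P) *: P) D
    = (2%:R * dot g P (R + S) / N P) ^+ 2 * (N P - dot g P (R + S) ^+ 2).
  by rewrite -bivsq_link_denominator /bivsq /bivdot !(dotZl, dotZr); ring.
by rewrite dotZl; move: (N P) N0 => n N0; field.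
Qed.

Hypothesis RS_sq : dot g R R = dot g S S.
Hypothesis D_sq : dot g D D != 0.

Lemma dot_DR : dot g D R = dot g D D / 2%:R.
Proof. by rewrite !dotE RS_sq (g_sym S R); field. Qed.

Lemma dot_DS : dot g D S = - (dot g D D / 2%:R).
Proof. by rewrite !dotE RS_sq (g_sym S R); field. Qed.

Lemma link_R P : N P != 0 -> link g R S P R = S.
Proof.
move=> N0; rewrite linkE dot_DR.
(* Because [D . R = D^2 / 2], the two terms along [P] cancel, and the numerator along [D] becomes
   [N P] itself. *)
transitivity (R + (0 *: P + - 1 *: D)).
  congr (_ + (_ *: _ + _ *: _)); first by field.
  by move: N0; set d := dot g D D => N0; field.
by rewrite scale0r add0r scaleN1r opprB addrC subrK.
Qed.

Lemma link_S P : N P != 0 -> let Q := mu g R S P *: P in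
  link g R S P S = (2%:R * dot g Q S) *: S + (1 - 2%:R * dot g Q S) *: R
                   - dot g D D *: Q.
Proof.
move=> N0 Q; rewrite linkE dot_DS /Q muE dotZl.
transitivity (S + (- (dot g D D * (2%:R * dot g P (R + S) / N P)) *: P
   + (1 - 2%:R * (2%:R * dot g P (R + S) / N P * dot g P S)) *: D)).
  congr (_ + (_ *: _ + _ *: _)).
    by rewrite (dotDr P); move: N0; set d := dot g D D => N0; field.
  by rewrite (dotDr P); move: N0; set d := dot g D D => N0; field.
set m := 2%:R * dot g P (R + S) / N P.
set y := 2%:R * (m * dot g P S); set d := dot g D D.
have -> : y *: S = S - (1 - y) *: S.
  by rewrite scalerBl scale1r opprB addrC subrK.
rewrite scalerBr scaleNr scalerA -!addrA; congr (_ + _).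
by rewrite addrC -addrA addrCA.
Qed.

(** * From an isometry link back to an admissible vector *)

Lemma admissible_of_wedge P : wedge P D != 0 -> dot g P (R + S) != 0 ->
  N P != 0 -> admissible g R S P.
Proof.
move=> w0 PS N0; split=> //; last exact: bivsq_link_denominator.
by apply: contraNneq PS => ->; rewrite /dot linear0 zero_lfunE.
Qed.

(** A zero bivector would give the identity, hence [R = S], contradicting [D^2 != 0]. *)
Lemma iso_link_wedge A B : iso g A B R = S -> wedge A B != 0.
Proof.
move=> LR; apply: contraNneq D_sq => /gen_wedge0 M0; move: LR.
rewrite /iso /isoc M0 comp_lfun0l scaler0 !addr0 id_lfunE => <-.
by rewrite subrr /dot linear0.
Qed.

(* [P] and [D] are independent, so their coefficients in [L R - R = - D] can be
   compared. *)
Lemma iso_link_scalars P : iso g P D R = S ->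
  dot g P (R + S) = gamma g P D + 1 /\ N P = 2%:R * (gamma g P D + 1).
Proof.
move=> LR; have w0 := iso_link_wedge LR.
move: LR (gamma1_neq0 P D); rewrite /iso isocE dot_DR.
set c := gamma g P D.
set x := (X in X *: P); set y := (X in _ + X *: D) => LR c1.
have /(wedge_free w0)[x0 y1] : x *: P + (y + 1) *: D = 0.
  rewrite scalerDl scale1r addrA; apply: (addrI R).
  by rewrite addrA LR addrC subrK addr0.
have eq1 : dot g P (R + S) = c + 1.
  apply: (mulfI D_sq); apply/eqP; rewrite eq_sym -subr_eq0; apply/eqP.
  (* Clearing denominators, [2 (c + 1) x = D^2 (c + 1 - P . (R + S))], and [D^2] can be
     cancelled. *)
  transitivity (2%:R * (c + 1) * x); last by rewrite x0 mulr0.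
  rewrite /x (g_sym D P) !(dotDr P) dotNr; move: c1; set d := dot g D D => c1.
  by field.
split=> //.
(* [N P - 2 (c + 1)] is a combination of the two quantities already known to vanish, [y + 1] and
   [P . (R + S) - (c + 1)]. *)
transitivity (2%:R * (c + 1) - 2%:R * (c + 1) * (y + 1)
  + 2%:R * dot g P R * (dot g P (R + S) - (c + 1))); last first.
  by rewrite y1 eq1 subrr !mulr0 subr0 addr0.
rewrite /y !(dotDr P) dotNr; move: c1; set d := dot g D D => c1.
by field.
Qed.

Lemma iso_link_gamma P : iso g P D R = S ->
  [/\ admissible g R S P, mu g R S P = 1,
      dot g P (R + S) = gamma g P D + 1 & iso g P D = link g R S P].
Proof.
move=> LR; have [eqPS eqN] := iso_link_scalars LR.
have PS : dot g P (R + S) != 0 by rewrite eqPS gamma1_neq0.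
have N0 : N P != 0 by rewrite eqN mulf_neq0 ?gamma1_neq0 ?pnatr_eq0.
have mu1 : mu g R S P = 1 by rewrite muE eqPS eqN divff // -eqN.
split=> //; first exact: admissible_of_wedge (iso_link_wedge LR) PS N0.
(* As [mu = 1], the scalar [q - 1] of [isoc_link] is [gamma g P D]. *)
by rewrite -(isoc_link PS N0) mu1 scale1r eqPS addrK.
Qed.

Lemma iso_link_factor A B : iso g A B R = S ->
  exists P, iso g A B = iso g P D.
Proof.
move=> LR; have : D != 0 by apply: contraNneq D_sq => ->; rewrite /dot linear0.
move: (LR); rewrite /iso isocE.
set x := (X in X *: A); set y := (X in _ + X *: B) => e.
have -> : D = (- x) *: A + (- y) *: B.
  by rewrite -[S in LHS]e opprD addrA subrr add0r opprD !scaleNr.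
by move=> /exists_wedge_factor[P eP]; exists P.
Qed.

End LinkEquation.

Theorem mainTheorem1 (K : realType) (V : vectType K) (g : metric V) (R S : V)
    (dimV : (2 <= \dim {:V})%N)
    (g_sym : symmetric_metric g) (g_inv : bijective g)
    (R_neq0 : R != 0) (S_neq0 : S != 0)
    (RS_orth : dot g (R - S) (R + S) = 0) (RS_sq : dot g R R - dot g S S = 0)
    (D_sq : dot g (R - S) (R - S) != 0) :
  (forall P : V, admissible g R S P ->
     let Q := mu g R S P *: P in
     let q := dot g Q (R + S) in
     [/\ (* Q depends only on the ray of P *)
         (forall k : K, k != 0 ->
            admissible g R S (k *: P) /\ mu g R S (k *: P) *: (k *: P) = Q),
         (* Q /\ (R - S) parameterizes an isometry *)
         bivsq g Q (R - S) <= 1 /\ g_isometry g (iso g Q (R - S)),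
         (* link identities, for the square root q - 1 of 1 - (Q /\ (R - S))^2 *)
         [/\ (q - 1) ^+ 2 = 1 - bivsq g Q (R - S),
             isoc g (q - 1) Q (R - S) = link g R S P,
             g_isometry g (link g R S P),
             link g R S P R = S
           & link g R S P S = (2%:R * dot g Q S) *: S + (1 - 2%:R * dot g Q S) *: R
                              - dot g (R - S) (R - S) *: Q],
         (* the root q - 1 is the nonnegative one, gamma, iff 1 <= q *)
         (gamma g Q (R - S) + 1 = q <-> 1 <= q)
         /\ (iso g Q (R - S) R = S <-> 1 <= q)
       & 1 <= q ->
         [/\ iso g Q (R - S) = link g R S P,
             gamma g Q (R - S) + 1 = q,
             iso g Q (R - S) R = S
           & iso g Q (R - S) S = (2%:R * dot g Q S) *: S + (1 - 2%:R * dot g Q S) *: R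
                                 - dot g (R - S) (R - S) *: Q]])
  /\
  (forall A B : V, bivsq g A B <= 1 -> iso g A B R = S ->
     exists P : V,
       [/\ admissible g R S P,
           1 <= dot g (mu g R S P *: P) (R + S),
           iso g A B = iso g (mu g R S P *: P) (R - S)
         & iso g A B = link g R S P]).
Proof.
have RS : dot g R R = dot g S S by apply/eqP; rewrite -subr_eq0 RS_sq.
split=> [P admP Q q | A B _ LR]; last first.
  have [P eP] := iso_link_factor g_sym D_sq LR.
  move: LR; rewrite eP => /(iso_link_gamma g_sym RS D_sq)[admP mu1 PS eL].
  (* The factor [P] already has [mu = 1], so the bound [1 <= q] becomes [0 <= gamma]. *)
  by exists P; rewrite mu1 scale1r PS lerDr gamma_ge0.
have [_ PS _ _ N0] := admP.
have root : (q - 1) ^+ 2 = 1 - bivsq g Q (R - S) by exact: root_link.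
have bivsq_le1 : bivsq g Q (R - S) <= 1 by rewrite -subr_ge0 -root sqr_ge0.
have qE : isoc g (q - 1) Q (R - S) = link g R S P by exact: isoc_link.
have q_neq0 : q - 1 + 1 != 0.
  rewrite subrK /q /Q muE // dotZl !mulf_neq0 ?invr_eq0 ?pnatr_eq0 //.
have gammaE : gamma g Q (R - S) + 1 = q <-> 1 <= q.
  (* By [root], [gamma] is the absolute value of [q - 1]. *)
  rewrite /gamma -root sqrtr_sqr; split=> [<-|q1]; first by rewrite lerDr.
  by rewrite ger0_norm ?subr_ge0 // subrK.
have isoE : 1 <= q -> iso g Q (R - S) = link g R S P.
  by move=> /gammaE e; rewrite -qE -e addrK.
have linkR : link g R S P R = S by exact: link_R.
have linkS := link_S g_sym RS N0.
split=> //.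
- by move=> k k0; split; [exact: admissibleZ | exact: muZ].
- by split=> //; exact: iso_isometry.
(* The isometry property goes through [isoc] with the root [q - 1], so it covers both signs of that
   root. *)
- by split=> //; rewrite -qE; exact: isoc_isometry.
- split=> //; split=> [LR|q1]; last by rewrite isoE.
  (* The converse analysis, applied to [Q] itself in place of [P], gives [q = gamma + 1]. *)
  have [_ _ eq _] := iso_link_gamma g_sym RS D_sq LR.
  by apply/gammaE; rewrite /q eq.
- by move=> q1; rewrite isoE //; split=> //; apply/gammaE.
Qed.
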